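(* For $\lambda>0$ consider the system $$\dot x=y,\qquad \dot y=-\left[x+\frac{\lambda}{(1+x)^2}\right]$$ in the region $x>-1$. There exists $\lambda_{d}(0)\in(0,\frac{4}{27})$ such that the solution starting at $(0,0)$ is periodic if and only if $\lambda<\lambda_{d}(0)$, and it approaches $(-1,-\infty)$ for $\lambda>\lambda_{d}(0)$. In fact, $\lambda_{d}(0)=\frac18$.
   Context: ''Approaches $(-1,-\infty)$'' means that $x(t)\to-1$ and $y(t)\to-\infty$ as $t$ tends to the right end-point of the maximal interval of existence. *)

(* Defs.v *)
From Stdlib Require Import Reals.
From Coquelicot Require Import Coquelicot.
Open Scope R_scope.

(** A curve [t |-> (pos t, vel t)] in the plane, considered on the open time
    interval [(tmin, tmax)] only; the values outside of it are irrelevant. *)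
Record curve := Curve {
  tmin : Rbar;
  tmax : Rbar;
  pos : R -> R;
  vel : R -> R
}.

Definition dom (c : curve) (t : R) : Prop :=
  Rbar_lt (tmin c) t /\ Rbar_lt t (tmax c).

Definition solution (lam x0 y0 : R) (c : curve) : Prop :=
  dom c 0 /\ pos c 0 = x0 /\ vel c 0 = y0 /\
  forall t, dom c t ->
    -1 < pos c t /\
    is_derive (pos c) t (vel c t) /\
    is_derive (vel c) t (- (pos c t + lam / (1 + pos c t) ^ 2)).

Definition extends (d c : curve) : Prop :=
  forall t, dom c t -> dom d t /\ pos d t = pos c t /\ vel d t = vel c t.

Definition maximal_solution (lam x0 y0 : R) (c : curve) : Prop :=
  solution lam x0 y0 c /\
  forall d, solution lam x0 y0 d -> extends d c -> forall t, dom d t -> dom c t.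

Definition periodic (c : curve) : Prop :=
  (forall t, dom c t) /\
  exists T, 0 < T /\
    forall t, pos c (t + T) = pos c t /\ vel c (t + T) = vel c t.

(** [t] tends to [tmax c] from below, whether [tmax c] is finite or [+oo]. *)
Definition to_tmax (c : curve) : (R -> Prop) -> Prop :=
  within (fun t : R => Rbar_lt t (tmax c)) (Rbar_locally (tmax c)).

Definition approaches_singularity (c : curve) : Prop :=
  filterlim (pos c) (to_tmax c) (locally (-1)) /\
  filterlim (vel c) (to_tmax c) (Rbar_locally m_infty).

(* Main.v *)
(** The energy [y ^ 2 / 2 + x ^ 2 / 2 - lam / (1 + x)] is conserved, so the
    orbit of the origin lies on [y ^ 2 = - x (x ^ 2 + x + 2 lam) / (1 + x)].
    The quadratic factor has real roots exactly when [lam <= 1 / 8]. For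
    [lam < 1 / 8] put [x = a sin^2 u], where [a] is its larger root; then
    [u' = sqrt (P u)] with [P] positive, bounded and periodic, so [u] reaches
    [PI] and the orbit closes. For [lam >= 1 / 8] put [x = - u ^ 2]; then
    [u' = sqrt (P u)] on [|u| < M], and [u] increases from 0 to [M]. If
    [lam > 1 / 8] then [M = 1] and the singularity is approached; if
    [lam = 1 / 8] then [- M ^ 2 = -1 / 2] is an equilibrium. Each
    first-order equation is solved by inverting the primitive of
    [1 / sqrt P], and uniqueness transfers the conclusions to every maximal
    solution. *)
From Stdlib Require Import Reals Lra Psatz ClassicalEpsilon Ranalysis5.
From Coquelicot Require Import Coquelicot.
Require Import Defs.
Open Scope R_scope.

(** * Derivatives and the mean value theorem *)

Lemma is_derive_continuity_pt (f : R -> R) (x l : R) :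
  is_derive f x l -> continuity_pt f x.
Proof.
  intros H. apply derivable_continuous_pt. exists l.
  now apply is_derive_Reals.
Qed.

(** [auto_derive] leaves [Derive] of an abstract function in its goals; [D] supplies the value to
    put there. *)
Ltac derive_value D :=
  match type of D with is_derive ?f ?x ?l =>
    replace (Derive (fun z => f z) x) with l
      by (symmetry; apply is_derive_unique; exact D)
  end.

Lemma derive_mvt (f df : R -> R) (a b : R) :
  a < b -> (forall x, a <= x <= b -> is_derive f x (df x)) ->
  exists c, a <= c <= b /\ f b - f a = df c * (b - a).
Proof.
  intros Hab Hf.
  destruct (MVT_gen f a b df) as [c [Hc E]].
  - rewrite Rmin_left, Rmax_right by lra. intros; apply Hf; lra.
  - rewrite Rmin_left, Rmax_right by lra. intros.
    eapply is_derive_continuity_pt; apply Hf; lra.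
  - rewrite Rmin_left, Rmax_right in Hc by lra. now exists c.
Qed.

(** * Uniqueness of trajectories *)

Definition trajectory (lam : R) (x y : R -> R) (t : R) : Prop :=
  -1 < x t /\ is_derive x t (y t) /\
  is_derive y t (- (x t + lam / (1 + x t) ^ 2)).

Lemma trajectory_unique (lam : R) (x1 y1 x2 y2 : R -> R) (a b t0 : R) :
  0 < lam -> a <= t0 <= b ->
  (forall t, a <= t <= b ->
     trajectory lam x1 y1 t /\ trajectory lam x2 y2 t) ->
  x1 t0 = x2 t0 -> y1 t0 = y2 t0 ->
  forall t, a <= t <= b -> x1 t = x2 t /\ y1 t = y2 t.
Proof.
  intros Hlam Ht0 H Hx Hy t Ht.
  (* [q] is the difference quotient of the singular force: [lam / (1 + x2) ^ 2 - lam / (1 + x1) ^ 2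
     = q * (x1 - x2)]. Its maximum over the compact interval serves as Lipschitz constant. *)
  set (q := fun s => lam * ((2 + x1 s + x2 s) / ((1 + x1 s) ^ 2 * (1 + x2 s) ^ 2))).
  assert (Hq : forall s, a <= s <= b -> 0 < q s).
  { intros s Hs. destruct (H s Hs) as [[P1 _] [P2 _]].
    unfold q. apply Rmult_lt_0_compat; auto. apply Rdiv_lt_0_compat; [lra|].
    apply Rmult_lt_0_compat; apply pow_lt; lra. }
  destruct (continuity_ab_maj q a b) as [s0 [HK _]]; [lra| |].
  { intros s Hs. destruct (H s Hs) as [[P1 [D1 _]] [P2 [D2 _]]].
    eapply is_derive_continuity_pt. unfold q.
    auto_derive; [|reflexivity].
    repeat split; [exists (y1 s)|exists (y2 s)|exists (y1 s)|exists (y2 s)|]; auto.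
    apply Rgt_not_eq. repeat apply Rmult_lt_0_compat; lra. }
  (* [w' = 2 q (x1 - x2) (y1 - y2)], so [|w'| <= K w] and [w] vanishes (Gronwall). *)
  set (K := q s0).
  set (w := fun s => (x1 s - x2 s) ^ 2 + (y1 s - y2 s) ^ 2).
  set (dw := fun s => 2 * q s * (x1 s - x2 s) * (y1 s - y2 s)).
  assert (Hdw : forall s, a <= s <= b -> is_derive w s (dw s)).
  { intros s Hs. destruct (H s Hs) as [[P1 [D1 E1]] [P2 [D2 E2]]].
    unfold w. auto_derive.
    - repeat split; eexists; eassumption.
    - derive_value D1; derive_value D2; derive_value E1; derive_value E2.
      unfold dw, q. field. split; lra. }
  assert (Hb : forall s, a <= s <= b -> Rabs (dw s) <= K * w s).
  { intros s Hs. unfold dw, w. specialize (Hq s Hs). specialize (HK s Hs).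
    fold K in HK. apply Rabs_le.
    pose proof (pow2_ge_0 (x1 s - x2 s + (y1 s - y2 s))).
    pose proof (pow2_ge_0 (x1 s - x2 s - (y1 s - y2 s))).
    pose proof (pow2_ge_0 (x1 s - x2 s)). pose proof (pow2_ge_0 (y1 s - y2 s)).
    nra. }
  assert (Hw0 : w t0 = 0).
  { unfold w. rewrite Hx, Hy. ring. }
  assert (Hwt : w t <= 0).
  (* After [t0], [w s * exp (- K * s)] cannot increase; before [t0], [w s * exp (K * s)] cannot
     decrease. Both vanish at [t0]. *)
  { destruct (Rtotal_order t0 t) as [L|[L|L]].
    - destruct (derive_mvt (fun s => w s * exp (- K * s))
        (fun s => (dw s - K * w s) * exp (- K * s)) t0 t) as [c [Hc E]]; auto.
      + intros s Hs. assert (D := Hdw s ltac:(lra)). auto_derive.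
        * eexists; eassumption.
        * derive_value D. ring.
      + rewrite Hw0 in E. specialize (Hb c ltac:(lra)).
        pose proof (Rle_abs (dw c)).
        pose proof (exp_pos (- K * c)). pose proof (exp_pos (- K * t)).
        assert ((dw c - K * w c) * exp (- K * c) * (t - t0) <= 0).
        { assert (0 <= (K * w c - dw c) * exp (- K * c) * (t - t0)); [|lra].
          repeat apply Rmult_le_pos; lra. }
        apply Rnot_lt_le. intros Hc'.
        pose proof (Rmult_lt_0_compat _ _ Hc' H2). lra.
    - subst. lra.
    - destruct (derive_mvt (fun s => w s * exp (K * s))
        (fun s => (dw s + K * w s) * exp (K * s)) t t0) as [c [Hc E]]; auto.
      + intros s Hs. assert (D := Hdw s ltac:(lra)). auto_derive.
        * eexists; eassumption.
        * derive_value D. ring.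
      + rewrite Hw0 in E. specialize (Hb c ltac:(lra)).
        pose proof (Rabs_maj2 (dw c)).
        pose proof (exp_pos (K * c)). pose proof (exp_pos (K * t)).
        assert (0 <= (dw c + K * w c) * exp (K * c) * (t0 - t)).
        { repeat apply Rmult_le_pos; lra. }
        apply Rnot_lt_le. intros Hc'.
        pose proof (Rmult_lt_0_compat _ _ Hc' H2). lra. }
  unfold w in Hwt.
  pose proof (pow2_ge_0 (x1 t - x2 t)). pose proof (pow2_ge_0 (y1 t - y2 t)).
  split; apply Rminus_diag_uniq; nra.
Qed.

(** * Autonomous first-order equations *)

(** Separation of variables: the primitive [T] of [h] is strictly increasing, and its inverse [s]
    has derivative [/ h (s t)]. Evenness of [h] makes [T] odd, so the range of [T] is a symmetric
    interval, possibly the whole line. *)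
Lemma inverse_of_primitive (m : Rbar) (h : R -> R) :
  Rbar_lt 0 m ->
  (forall u, Rbar_lt (Rabs u) m -> continuous h u /\ 0 < h u /\ h (- u) = h u) ->
  exists (tau : Rbar) (s : R -> R),
    Rbar_lt 0 tau /\ s 0 = 0 /\
    (forall t, Rbar_lt (Rabs t) tau ->
       Rbar_lt (Rabs (s t)) m /\ is_derive s t (/ h (s t))) /\
    (forall t t', Rbar_lt (Rabs t) tau -> Rbar_lt (Rabs t') tau ->
       t < t' -> s t < s t') /\
    (forall u, Rbar_lt (Rabs u) m ->
       exists t, Rbar_lt (Rabs t) tau /\ s t = u).
Proof.
  intros Hm Hh.
  assert (Hbet : forall (k : Rbar) a b u,
    Rbar_lt (Rabs a) k -> Rbar_lt (Rabs b) k -> a <= u <= b -> Rbar_lt (Rabs u) k).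
  { intros k a b u Ha Hb Hu. unfold Rabs in *.
    destruct k; simpl in *; auto.
    destruct (Rcase_abs a), (Rcase_abs b), (Rcase_abs u); lra. }
  set (T := (fun u => RInt h 0 u) : R -> R).
  assert (HT0 : T 0 = 0) by (unfold T; apply (RInt_point 0 h)).
  assert (Z : Rbar_lt (Rabs 0) m) by (rewrite Rabs_R0; auto).
  assert (HT : forall u, Rbar_lt (Rabs u) m -> is_derive T u (h u)).
  { intros u Hu. apply (is_derive_RInt h T 0 u); [|now apply Hh].
    assert (Rbar_lt u m /\ Rbar_lt (Rbar_opp m) u) as [U1 U2].
    { destruct m; simpl in *; auto. apply Rabs_def2 in Hu. lra. }
    apply (locally_interval _ u (Rbar_opp m) m U2 U1).
    intros v V1 V2. apply (RInt_correct h 0 v). apply (ex_RInt_continuous h).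
    intros z Hz. apply Hh.
    assert (Rbar_lt (Rabs v) m).
    { destruct m; simpl in *; auto. apply Rabs_def1; lra. }
    destruct (Rle_dec 0 v).
    - rewrite Rmin_left, Rmax_right in Hz by lra. eapply Hbet; [exact Z|eassumption|lra].
    - rewrite Rmin_right, Rmax_left in Hz by lra. eapply Hbet; [eassumption|exact Z|lra]. }
  assert (Hinc : forall u v, Rbar_lt (Rabs u) m -> Rbar_lt (Rabs v) m -> u < v -> T u < T v).
  { intros u v Hu Hv L.
    destruct (derive_mvt T h u v L) as [c [Hc E]].
    - intros; apply HT. now apply (Hbet m u v).
    - assert (0 < h c) by (apply Hh; now apply (Hbet m u v)). nra. }
  assert (Hodd : forall u, Rbar_lt (Rabs u) m -> T (- u) = - T u).
  { assert (P : forall u, 0 < u -> Rbar_lt (Rabs u) m -> T (- u) = - T u).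
    { intros u L Hu.
      destruct (derive_mvt (fun v => T v + T (- v)) (fun v => h v - h (- v)) 0 u L) as [c [Hc E]].
      - intros v Hv. assert (Hv' : Rbar_lt (Rabs v) m) by now apply (Hbet m 0 u).
        assert (Hv'' : Rbar_lt (Rabs (- v)) m) by now rewrite Rabs_Ropp.
        assert (D1 := HT _ Hv'). assert (D2 := HT _ Hv'').
        auto_derive.
        + repeat split; eexists; eassumption.
        + derive_value D1.
          derive_value D2. ring.
      - destruct (Hh c) as [_ [_ Ec]]; [now apply (Hbet m 0 u)|].
        rewrite Ec, Ropp_0, HT0 in E. lra. }
    intros u Hu. destruct (Rtotal_order 0 u) as [L|[L|L]].
    - auto.
    - subst. rewrite Ropp_0. lra.
    - rewrite <- (Ropp_involutive u) at 2. rewrite (P (- u)); try lra.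
      now rewrite Rabs_Ropp. }
  set (E := fun t : R => exists u, Rbar_lt (Rabs u) m /\ T u = t).
  destruct (Lub_Rbar_correct E) as [Hub Hlub].
  set (tau := Lub_Rbar E) in *.
  (* The condition [|u| < m] is open, so a larger [v] gives a larger value of [T]: the supremum
     [tau] is never attained. *)
  assert (Hlt : forall u, Rbar_lt (Rabs u) m -> Rbar_lt (T u) tau).
  { intros u Hu. assert (exists v, u < v /\ Rbar_lt (Rabs v) m) as [v [L Hv]].
    { destruct m as [m| |]; simpl in *; [| |easy].
      - apply Rabs_def2 in Hu. exists ((u + m) / 2). split; [lra|].
        apply Rabs_def1; lra.
      - exists (u + 1). split; [lra|auto]. }
    apply Rbar_lt_le_trans with (T v).
    - simpl. now apply Hinc.
    - apply Hub. now exists v. }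
  assert (Hlta : forall u, Rbar_lt (Rabs u) m -> Rbar_lt (Rabs (T u)) tau).
  { intros u Hu. assert (A1 := Hlt u Hu).
    assert (A2 := Hlt (- u) ltac:(now rewrite Rabs_Ropp)).
    rewrite Hodd in A2 by auto. unfold Rabs. now destruct (Rcase_abs (T u)). }
  assert (Hex : forall t : R, Rbar_lt t tau -> exists u, Rbar_lt (Rabs u) m /\ t < T u).
  { intros t Ht. apply NNPP. intros N.
    apply (Rbar_lt_not_le _ _ Ht). apply Hlub.
    intros e [u [Hu <-]]. simpl. apply Rnot_lt_le. intros L. apply N. now exists u. }
  assert (Hsurj : forall t, Rbar_lt (Rabs t) tau -> exists u, Rbar_lt (Rabs u) m /\ T u = t).
  { intros t Ht.
    assert (Rbar_lt t tau /\ Rbar_lt (- t) tau) as [U1 U2].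
    { destruct tau; simpl in *; auto. apply Rabs_def2 in Ht. lra. }
    destruct (Hex _ U1) as [b [Hb Lb]]. destruct (Hex _ U2) as [a' [Ha La]].
    assert (Ha' : Rbar_lt (Rabs (- a')) m) by now rewrite Rabs_Ropp.
    set (a := - a') in *. assert (La' : T a < t) by (unfold a; rewrite Hodd by auto; lra).
    assert (Lab : a < b).
    { apply Rnot_le_lt. intros [L|L]; [specialize (Hinc b a Hb Ha' L)|rewrite L in *]; lra. }
    destruct (IVT_interv (fun u => T u - t) a b) as [u [Hu Eu]]; try lra.
    - intros v Hv. eapply is_derive_continuity_pt.
      assert (D := HT v ltac:(now apply (Hbet m a b))).
      auto_derive; [eexists; eassumption|reflexivity].
    - exists u. split; [now apply (Hbet m a b)|lra]. }
  (* Guarding the property by [|t| < tau] allows a total choice function; [s] is arbitrary outside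
     this interval. *)
  assert (Htot : forall t, exists u, Rbar_lt (Rabs t) tau -> Rbar_lt (Rabs u) m /\ T u = t).
  { intros t. destruct (excluded_middle_informative (Rbar_lt (Rabs t) tau)) as [L|L].
    - destruct (Hsurj t L) as [u Hu]. now exists u.
    - exists 0. easy. }
  set (s := fun t => proj1_sig (constructive_indefinite_description _ (Htot t))).
  assert (Hs : forall t, Rbar_lt (Rabs t) tau -> Rbar_lt (Rabs (s t)) m /\ T (s t) = t).
  { intros t Ht. unfold s. destruct (constructive_indefinite_description _ (Htot t)) as [u Hu]. simpl. auto. }
  assert (Hinj : forall u v, Rbar_lt (Rabs u) m -> Rbar_lt (Rabs v) m -> T u = T v -> u = v).
  { intros u v Hu Hv Euv. destruct (Rtotal_order u v) as [L|[L|L]]; auto;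
    apply Hinc in L; auto; lra. }
  assert (HsT : forall u, Rbar_lt (Rabs u) m -> s (T u) = u).
  { intros u Hu. destruct (Hs (T u)) as [A B]; auto. }
  assert (Hsinc : forall t t', Rbar_lt (Rabs t) tau -> Rbar_lt (Rabs t') tau ->
       t < t' -> s t < s t').
  { intros t t' Ht Ht' L. destruct (Hs t Ht) as [A B]. destruct (Hs t' Ht') as [A' B'].
    apply Rnot_le_lt. intros [L'|L'].
    - apply Hinc in L'; auto. lra.
    - rewrite L' in B'. lra. }
  exists tau, s. split; [|split; [|split; [|split]]]; auto.
  - rewrite <- HT0. auto.
  - rewrite <- HT0 at 1. auto.
  - intros t H. split; [now apply Hs|].
    destruct (Hs t H) as [Hu Eu]. remember (s t) as u eqn:Es.
    assert (exists a b, a < u < b /\ Rbar_lt (Rabs a) m /\ Rbar_lt (Rabs b) m) as [a [b [Hab [Ha Hb]]]].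
    { destruct m as [m| |]; simpl in *; [| |easy].
      - apply Rabs_def2 in Hu. exists ((u - m) / 2), ((u + m) / 2).
        split; [lra|]. split; apply Rabs_def1; lra.
      - exists (u - 1), (u + 1). split; [lra|auto]. }
    assert (Hd : forall v, a <= v <= b -> derivable_pt T v).
    { intros v Hv. exists (h v). apply is_derive_Reals. apply HT. now apply (Hbet m a b). }
    assert (Hbd : T a < t < T b).
    { rewrite <- Eu. split; apply Hinc; auto; lra. }
    (* The inverse function theorem on [[a, b]] gives differentiability; the value of the derivative
       then comes from differentiating [T (s z) = z]. *)
    assert (Ds : derivable_pt s t).
    { assert (Lab : a < b) by lra.
      assert (Hc : forall z, T a <= z -> z <= T b -> comp T s z = id z).
      { intros z Z1 Z2. unfold comp, id. apply Hs.
        apply (Hbet tau (T a) (T b)); auto. }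
      assert (Hw : forall z, T a <= z -> z <= T b -> a <= s z <= b).
      { intros z Z1 Z2. rewrite <- (HsT a), <- (HsT b) by auto.
        assert (Rbar_lt (Rabs z) tau) by (apply (Hbet tau (T a) (T b)); auto).
        split.
        - destruct Z1 as [Z1|Z1]; [left; auto|rewrite Z1; lra].
        - destruct Z2 as [Z2|Z2]; [left; auto|rewrite Z2; lra]. }
      apply (derivable_pt_recip_interv T s a b t Lab Hbd Hc Hw)
        with (f_derivable := Hd).
      - intros z z' Z1 L Z2. apply Hinc; auto; apply (Hbet m a b); auto; lra.
      - apply Rgt_not_eq. rewrite Derive_Reals, <- Es.
        rewrite (is_derive_unique _ _ _ (HT _ Hu)). now apply Hh. }
    destruct Ds as [l Dl]. apply is_derive_Reals in Dl.
    assert (Dc : is_derive (fun z => T (s z)) t (l * h u)).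
    { apply (is_derive_comp T s); [rewrite <- Es|]; auto. }
    assert (Di : is_derive (fun z => T (s z)) t 1).
    { apply (is_derive_ext_loc (fun z => z)); [|apply (is_derive_id t)].
      apply (locally_interval _ t (T a) (T b)); try (simpl; lra).
      intros z Z1 Z2. symmetry. apply Hs. apply (Hbet tau (T a) (T b)); auto.
      simpl in *; lra. }
    assert (El : l * h u = 1).
    { apply is_derive_unique in Dc. apply is_derive_unique in Di. congruence. }
    assert (0 < h u) by now apply Hh.
    assert (El' : l = / h u).
    { apply (Rmult_eq_reg_r (h u)); [rewrite Rinv_l|]; lra. }
    rewrite <- El'. exact Dl.
  - intros u Hu. exists (T u). auto.
Qed.

(** * Symmetric domains, time reversal and maximal solutions *)

Lemma Rbar_lt_Rabs (t : R) (tau : Rbar) :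
  Rbar_lt (Rabs t) tau <-> Rbar_lt (Rbar_opp tau) t /\ Rbar_lt t tau.
Proof.
  destruct tau; simpl; try tauto.
  split; intros H.
  - apply Rabs_def2 in H. lra.
  - apply Rabs_def1; lra.
Qed.

Definition symmetric_curve (tau : Rbar) (x y : R -> R) : curve :=
  Curve (Rbar_opp tau) tau x y.

Lemma dom_symmetric_curve (tau : Rbar) (x y : R -> R) (t : R) :
  dom (symmetric_curve tau x y) t <-> Rbar_lt (Rabs t) tau.
Proof. symmetry. apply Rbar_lt_Rabs. Qed.

Lemma dom_between (c : curve) (a b t : R) :
  dom c a -> dom c b -> a <= t <= b -> dom c t.
Proof.
  intros [A _] [_ B] H. split.
  - now apply Rbar_lt_le_trans with a.
  - now apply Rbar_le_lt_trans with b.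
Qed.

Lemma solution_unique (lam x0 y0 : R) (c d : curve) (t : R) :
  0 < lam -> solution lam x0 y0 c -> solution lam x0 y0 d ->
  dom c t -> dom d t -> pos c t = pos d t /\ vel c t = vel d t.
Proof.
  intros Hlam [C0 [Cx [Cy HC]]] [D0 [Dx [Dy HD]]] Ct Dt.
  assert (Hm : forall e : curve, dom e 0 -> dom e t ->
    forall s, Rmin 0 t <= s <= Rmax 0 t -> dom e s).
  { intros e E0 Et s Hs. unfold Rmin, Rmax in Hs.
    destruct (Rle_dec 0 t);
      [apply (dom_between e 0 t)|apply (dom_between e t 0)]; auto. }
  apply (trajectory_unique lam _ _ _ _ (Rmin 0 t) (Rmax 0 t) 0); auto.
  - split; [apply Rmin_l|apply Rmax_l].
  - intros s Hs. split; [apply HC|apply HD]; auto.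
  - congruence.
  - congruence.
  - split; [apply Rmin_r|apply Rmax_r].
Qed.

(** The force depends on the position alone, so [(t, x, y) -> (- t, x, - y)] preserves the system;
    it also fixes an initial state with zero velocity. *)
Lemma solution_reverse (lam : R) (d : curve) :
  solution lam 0 0 d ->
  solution lam 0 0 (Curve (Rbar_opp (tmax d)) (Rbar_opp (tmin d))
                      (fun t => pos d (- t)) (fun t => - vel d (- t))).
Proof.
  intros [[A B] [Dx [Dy H]]].
  assert (F : forall t : R, Rbar_lt (Rbar_opp (tmax d)) t ->
    Rbar_lt t (Rbar_opp (tmin d)) -> dom d (- t)).
  { intros t T1 T2. unfold dom.
    destruct (tmin d), (tmax d); simpl in *; split; auto; lra. }
  split; [|split; [|split]]; simpl.
  - unfold dom; simpl. destruct (tmin d), (tmax d); simpl in *; split; auto; lra.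
  - now rewrite Ropp_0.
  - rewrite Ropp_0, Dy. lra.
  - intros t [T1 T2]; simpl in *. destruct (H (- t) (F t T1 T2)) as [P [D E]].
    split; [auto|split].
    + auto_derive; [eexists; eassumption|]. derive_value D. ring.
    + auto_derive; [eexists; eassumption|]. derive_value E. ring.
Qed.

(** A negative time of [d] is a positive time of the reversed solution, so bounding positive times
    bounds both ends. *)
Lemma dom_symmetric_of_half (lam : R) (tau : Rbar) (x y : R -> R) :
  Rbar_lt 0 tau ->
  (forall d t, solution lam 0 0 d -> dom d t -> 0 < t -> Rbar_lt t tau) ->
  forall d t, solution lam 0 0 d -> dom d t -> dom (symmetric_curve tau x y) t.
Proof.
  intros Ht H d t Hd Dt. apply dom_symmetric_curve.
  destruct (Rtotal_order 0 t) as [L|[L|L]].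
  - rewrite Rabs_pos_eq by lra. eauto.
  - subst. now rewrite Rabs_R0.
  - rewrite Rabs_left by lra.
    apply (H _ _ (solution_reverse lam d Hd)); [|lra].
    destruct Dt as [A B]. unfold dom; simpl.
    destruct (tmin d), (tmax d); simpl in *; split; auto; lra.
Qed.

(* Uniqueness makes [C] an extension of every solution [d], so no gluing is
   needed to compare [C] with another maximal solution. *)
Lemma maximal_of_largest (lam : R) (C : curve) :
  0 < lam -> solution lam 0 0 C ->
  (forall d t, solution lam 0 0 d -> dom d t -> dom C t) ->
  maximal_solution lam 0 0 C /\
  forall c, maximal_solution lam 0 0 c ->
    forall t, (dom c t <-> dom C t) /\
      (dom C t -> pos c t = pos C t /\ vel c t = vel C t).
Proof.
  intros Hlam HC H. split.
  - split; eauto.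
  - intros c [Hc Hm] t.
    assert (E : forall t, dom C t -> dom c t).
    { apply Hm; auto. intros u Hu. split; eauto.
      assert (dom C u) by eauto.
      destruct (solution_unique lam 0 0 c C u); auto. }
    split; [split; eauto|]. intros Ht. apply (solution_unique lam 0 0); auto.
Qed.

(** Domains are open: the smaller of two distinct right end-points would be a time of one curve
    only. Having 0 in the domain excludes empty intervals. *)
Lemma tmax_eq (c d : curve) :
  dom c 0 -> (forall t, dom c t <-> dom d t) -> tmax c = tmax d.
Proof.
  assert (P : forall c d, dom c 0 -> dom d 0 ->
    (forall t, dom d t -> dom c t) -> ~ Rbar_lt (tmax c) (tmax d)).
  { intros e f [E1 E2] [F1 F2] H L. unfold dom in H.
    destruct (tmax e) as [r| |]; simpl in *; try easy.
    destruct (H r) as [_ B].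
    - split; auto. apply Rbar_lt_trans with 0; auto.
    - lra. }
  intros C0 H. assert (D0 : dom d 0) by now apply H.
  assert (A := P c d C0 D0 (fun t => proj2 (H t))).
  assert (B := P d c D0 C0 (fun t => proj1 (H t))).
  apply Rbar_not_lt_le in A, B. now apply Rbar_le_antisym.
Qed.

(** * Solutions from a change of variable *)

(* The last equation is the derivative of the energy identity
   [y ^ 2 = phi' ^ 2 * P] divided by [2 phi']. Choosing [phi] critical at [0]
   keeps [P] positive at the turning point [x = 0]. *)
Lemma chart_solution (lam : R) (m : Rbar) (P dP phi dphi ddphi : R -> R) :
  Rbar_lt 0 m -> phi 0 = 0 -> dphi 0 = 0 ->
  (forall u, Rbar_lt (Rabs u) m ->
     0 < P u /\ P (- u) = P u /\ is_derive P u (dP u) /\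
     is_derive phi u (dphi u) /\ is_derive dphi u (ddphi u) /\ -1 < phi u /\
     ddphi u * P u + dphi u * dP u / 2 = - (phi u + lam / (1 + phi u) ^ 2)) ->
  exists (tau : Rbar) (s : R -> R),
    Rbar_lt 0 tau /\ s 0 = 0 /\
    (forall t, Rbar_lt (Rabs t) tau ->
       Rbar_lt (Rabs (s t)) m /\ is_derive s t (sqrt (P (s t)))) /\
    (forall t t', Rbar_lt (Rabs t) tau -> Rbar_lt (Rabs t') tau ->
       t < t' -> s t < s t') /\
    (forall u, Rbar_lt (Rabs u) m ->
       exists t, Rbar_lt (Rabs t) tau /\ s t = u) /\
    solution lam 0 0 (symmetric_curve tau (fun t => phi (s t))
                        (fun t => dphi (s t) * sqrt (P (s t)))).
Proof.
  intros Hm Hp0 Hd0 H.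
  destruct (inverse_of_primitive m (fun u => / sqrt (P u)) Hm)
    as [tau [s [Ht [Hs0 [Hs [Hmono Hsurj]]]]]].
  { intros u Hu. destruct (H u Hu) as [P0 [Pe [PD _]]].
    split; [|split].
    - apply (ex_derive_continuous (fun u => / sqrt (P u))). auto_derive.
      repeat split; auto; [eexists; eassumption|].
      apply Rgt_not_eq. now apply sqrt_lt_R0.
    - apply Rinv_0_lt_compat. now apply sqrt_lt_R0.
    - now rewrite Pe. }
  exists tau, s.
  assert (Hs' : forall t, Rbar_lt (Rabs t) tau ->
       Rbar_lt (Rabs (s t)) m /\ is_derive s t (sqrt (P (s t)))).
  { intros t Htt. destruct (Hs t Htt) as [A B]. split; auto.
    now rewrite Rinv_inv in B. }
  repeat (split; [now auto|]).
  split; [|split; [|split]]; unfold symmetric_curve; cbn [pos vel].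
  - apply dom_symmetric_curve. now rewrite Rabs_R0.
  - now rewrite Hs0.
  - rewrite Hs0, Hd0. ring.
  - intros t Dt. apply dom_symmetric_curve in Dt.
    destruct (Hs' t Dt) as [A D].
    destruct (H _ A) as [P0 [_ [DP [D0 [D1 [P1 E]]]]]].
    split; [auto|split].
    + auto_derive; [repeat split; eexists; eassumption|].
      derive_value D. derive_value D0. ring.
    + assert (Hsq : 0 < sqrt (P (s t))) by now apply sqrt_lt_R0.
      auto_derive; [repeat split; auto; eexists; eassumption|].
      derive_value D. derive_value D1. derive_value DP.
      (* The chain rule gives [ddphi * r ^ 2 + dphi * dP / 2] with [r = sqrt (P (s t))]; writing [P]
         as [r ^ 2] leaves a rational identity. *)
      assert (Hr : P (s t) = sqrt (P (s t)) ^ 2) by (rewrite pow2_sqrt; lra).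
      set (r := sqrt (P (s t))) in *. clearbody r.
      rewrite <- E, Hr. field. lra.
Qed.

(** * Limits at the right end-point *)

Lemma filterlim_reparametrization (M : R) (tau : Rbar) (s : R -> R) :
  0 < M ->
  (forall t, Rbar_lt (Rabs t) tau -> Rabs (s t) < M) ->
  (forall t t', Rbar_lt (Rabs t) tau -> Rbar_lt (Rabs t') tau ->
     t < t' -> s t < s t') ->
  (forall u, Rabs u < M -> exists t, Rbar_lt (Rabs t) tau /\ s t = u) ->
  filterlim s (within (fun t : R => Rbar_lt t tau) (Rbar_locally tau)) (at_left M).
Proof.
  intros M_pos s_bound s_mono s_onto Q [e He].
  (* The maximum with 0 keeps [|u| < M] even for large [e], so [u] is a value of [s]; monotonicity
     then traps [s] between [u] and [M]. *)
  set (u := Rmax 0 (M - e)).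
  assert (U1 : 0 <= u) by apply Rmax_l.
  assert (U2 : M - e <= u) by apply Rmax_r.
  assert (U3 : u < M) by (apply Rmax_lub_lt; [|destruct e; simpl]; lra).
  destruct (s_onto u) as [t0 [Ht0 E0]]; [rewrite Rabs_pos_eq; lra|].
  assert (G : forall t : R, t0 < t -> Rbar_lt t tau -> Q (s t)).
  { intros t L Ht.
    assert (Htt : Rbar_lt (Rabs t) tau).
    { apply Rbar_lt_Rabs. split; auto. apply Rbar_lt_trans with t0; auto.
      now apply Rbar_lt_Rabs. }
    assert (B := s_bound _ Htt). apply Rabs_def2 in B.
    assert (s t0 < s t) by auto.
    apply He; [|lra]. apply Rabs_def1; simpl; unfold minus, plus, opp; simpl; lra. }
  apply Rbar_lt_Rabs in Ht0. destruct Ht0 as [_ Ht0].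
  unfold filtermap, within. destruct tau as [r| |]; simpl in *; [| |easy].
  - apply (locally_interval _ r t0 p_infty); simpl; auto.
  - exists t0. auto.
Qed.

(** Locates a solution that is supposed to continue up to [tau]: both sides are limits of [f (s t)]
    as [t] increases to [r], and limits are unique. *)
Lemma endpoint_value (M : R) (tau : Rbar) (s f g : R -> R) (r : R) :
  0 < M ->
  (forall t, Rbar_lt (Rabs t) tau -> Rabs (s t) < M) ->
  (forall t t', Rbar_lt (Rabs t) tau -> Rbar_lt (Rabs t') tau ->
     t < t' -> s t < s t') ->
  (forall u, Rabs u < M -> exists t, Rbar_lt (Rabs t) tau /\ s t = u) ->
  tau = Finite r -> 0 < r ->
  continuous f M -> continuous g r ->
  (forall t, 0 < t < r -> g t = f (s t)) -> g r = f M.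
Proof.
  intros M_pos s_bound s_mono s_onto Et Hr Hf Hg E.
  assert (L := filterlim_reparametrization M tau s M_pos s_bound s_mono s_onto). rewrite Et in L.
  apply (filterlim_locally_unique (F := at_left r) g).
  - intros Q HQ. apply (filter_imp (F := locally r) (fun t => Q (g t)));
      [auto|exact (Hg Q HQ)].
  - apply (filterlim_ext_loc (fun t => f (s t))).
    + apply (locally_interval _ r 0 p_infty); simpl; auto.
      intros y Y _ Y'. symmetry. apply E. lra.
    + apply (filterlim_comp _ _ _ s f (at_left r) (at_left M)); auto.
      intros Q HQ. apply (filter_imp (F := locally M) (fun t => Q (f t)));
        [auto|exact (Hf Q HQ)].
Qed.

(** * The case [lam < 1 / 8] *)

Lemma periodic_curve (lam : R) :
  0 < lam < 1 / 8 ->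
  exists C, solution lam 0 0 C /\ (forall t, dom C t) /\ periodic C.
Proof.
  intros Hlam.
  set (r := sqrt (1 - 8 * lam)).
  assert (r0 : 0 < r) by (apply sqrt_lt_R0; lra).
  assert (r2 : r * r = 1 - 8 * lam) by (apply sqrt_sqrt; lra).
  set (a := (-1 + r) / 2).
  assert (Ha : -1 / 2 < a < 0) by (unfold a; nra).
  assert (El : lam = - a * (1 + a) / 2) by (unfold a; nra).
  clearbody a. clear r r0 r2.
  (* From [x ^ 2 + x + 2 * lam = (x - a) * (x + 1 + a)] and [x - a = - a * cos u ^ 2], the energy
     identity loses the factor [a ^ 2 * sin u ^ 2 * cos u ^ 2] and leaves [P u] for the square of
     [u']. Positivity of [P] rests on [1 + 2 * a > 0]. *)
  set (P := fun u => (1 + a + a * sin u ^ 2) / (4 * (1 + a * sin u ^ 2))).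
  assert (Hsin : forall u, 0 <= sin u ^ 2 <= 1 /\ cos u ^ 2 = 1 - sin u ^ 2).
  { intros u. pose proof (sin2_cos2 u) as E. unfold Rsqr in E.
    pose proof (pow2_ge_0 (sin u)). pose proof (pow2_ge_0 (cos u)).
    split; nra. }
  destruct (chart_solution lam p_infty P
    (fun u => - a ^ 2 * sin u * cos u / (2 * (1 + a * sin u ^ 2) ^ 2))
    (fun u => a * sin u ^ 2) (fun u => 2 * a * sin u * cos u)
    (fun u => 2 * a * (cos u ^ 2 - sin u ^ 2)))
    as [tau [s [Ht [Hs0 [Hs [Hmono [Hsurj Hsol]]]]]]].
  - exact I.
  - rewrite sin_0. ring.
  - rewrite sin_0. ring.
  - intros u _. destruct (Hsin u) as [S C].
    assert (Q1 : 0 < 1 + a * sin u ^ 2) by nra.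
    assert (Q2 : 0 < 1 + a + a * sin u ^ 2) by nra.
    unfold P. split; [|split; [|split; [|split; [|split; [|split]]]]].
    + apply Rdiv_lt_0_compat; lra.
    + replace (sin (- u) ^ 2) with (sin u ^ 2) by (rewrite sin_neg; ring). reflexivity.
    + auto_derive; [simpl in *; lra|]. field. simpl in *; lra.
    + auto_derive; [auto|]. ring.
    + auto_derive; [auto|]. ring.
    + lra.
    + rewrite El.
      transitivity (2 * a * (cos u ^ 2 - sin u ^ 2) *
        ((1 + a + a * sin u ^ 2) / (4 * (1 + a * sin u ^ 2))) -
        a ^ 3 * sin u ^ 2 * cos u ^ 2 / (2 * (1 + a * sin u ^ 2) ^ 2)).
      { field. lra. }
      rewrite C. field. lra.
  (* Since [P <= 1], [s] has speed at most 1 and cannot reach the value [r] before time [r], so a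
     finite [tau = r] is impossible. *)
  - assert (Htau : tau = p_infty).
    { destruct tau as [r| |]; [exfalso|easy|easy]. simpl in Ht.
      assert (B0 : Rabs 0 < r) by (rewrite Rabs_R0; auto).
      destruct (Hsurj r I) as [t [Bt Et]].
      assert (L : 0 < t).
      { apply Rnot_le_lt. intros [L|L].
        - specialize (Hmono t 0 Bt B0 L). lra.
        - subst. lra. }
      simpl in Bt. apply Rabs_def2 in Bt.
      destruct (derive_mvt s (fun z => sqrt (P (s z))) 0 t L) as [c [Hc E]].
      { intros z Hz. apply Hs. simpl. apply Rabs_def1; lra. }
      assert (sqrt (P (s c)) <= 1).
      { rewrite <- sqrt_1. apply sqrt_le_1_alt. unfold P.
        destruct (Hsin (s c)) as [S _].
        apply Rmult_le_reg_r with (4 * (1 + a * sin (s c) ^ 2)); [nra|].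
        unfold Rdiv. rewrite Rmult_assoc, Rinv_l by nra. nra. }
      nra. }
    subst tau.
    eexists. split; [exact Hsol|].
    assert (Hall : forall t, dom (symmetric_curve p_infty (fun t => a * sin (s t) ^ 2)
       (fun t => 2 * a * sin (s t) * cos (s t) * sqrt (P (s t)))) t) by (intros; split; exact I).
    split; [exact Hall|]. split; [exact Hall|].
    (* At the time [T] when [s] reaches [PI] the sine vanishes and the state is again the origin;
       uniqueness identifies the shifted trajectory with the original one. *)
    destruct (Hsurj PI I) as [T [_ ET]]. exists T. split.
    + pose proof PI_RGT_0. apply Rnot_le_lt. intros [L|L].
      * specialize (Hmono T 0 I I L). lra.
      * subst T. lra.
    + intros t. destruct Hsol as [_ [X0 [Y0 H]]].
      cbn [pos vel symmetric_curve] in *.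
      set (x := fun t => a * sin (s t) ^ 2) in *.
      set (y := fun t => 2 * a * sin (s t) * cos (s t) * sqrt (P (s t))) in *.
      change (x 0 = 0) in X0. change (y 0 = 0) in Y0.
      apply (trajectory_unique lam (fun t => x (t + T)) (fun t => y (t + T)) x y
        (- Rabs t) (Rabs t) 0); try lra.
      * pose proof (Rabs_pos t). lra.
      * intros z _. split; [|exact (H z (Hall z))].
        destruct (H (z + T) (Hall (z + T))) as [A [D E]].
        change (is_derive x (z + T) (y (z + T))) in D.
        change (is_derive y (z + T) (- (x (z + T) + lam / (1 + x (z + T)) ^ 2))) in E.
        split; [exact A|split].
        -- auto_derive; [eexists; eassumption|]. derive_value D. ring.
        -- auto_derive; [eexists; eassumption|]. derive_value E. ring.
      * rewrite X0. unfold x. rewrite Rplus_0_l, ET, sin_PI. ring.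
      * rewrite Y0. unfold y. rewrite Rplus_0_l, ET, sin_PI. ring.
      * pose proof (Rle_abs t). pose proof (Rle_abs (- t)). rewrite Rabs_Ropp in *. lra.
Qed.

(** * The case [lam >= 1 / 8] *)

(** For [lam = 1 / 8] the state [(-1 / 2, 0)] is an equilibrium; uniqueness run backwards from [r]
    would place [d] there at time 0, against [pos d 0 = 0]. *)
Lemma equilibrium_not_reached (d : curve) (r : R) :
  solution (1 / 8) 0 0 d -> dom d r -> 0 <= r ->
  pos d r = -1 / 2 -> vel d r = 0 -> False.
Proof.
  intros [D0 [X0 [_ H]]] Dr Hr Xr Yr.
  destruct (trajectory_unique (1 / 8) (pos d) (vel d)
    (fun _ => -1 / 2) (fun _ => 0) 0 r r) with (t := 0) as [E _]; try lra.
  intros t Ht. split.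
  - apply H. now apply (dom_between d 0 r).
  - split; [lra|split].
    + apply (is_derive_const (-1 / 2) t).
    + replace (- (-1 / 2 + 1 / 8 / (1 + -1 / 2) ^ 2)) with 0 by field.
      apply (is_derive_const 0 t).
Qed.

Lemma filterlim_velocity_m_infty (lam : R) :
  1 / 8 < lam ->
  filterlim (fun u => - 2 * u * sqrt ((u ^ 4 - u ^ 2 + 2 * lam) / (4 * (1 - u ^ 2))))
    (at_left 1) (Rbar_locally m_infty).
Proof.
  intros Hlam Q [N HN].
  set (K := Rmax 1 (- N)). assert (K1 : 1 <= K) by apply Rmax_l.
  assert (K2 : - N <= K) by apply Rmax_r.
  set (mu := lam - 1 / 8). assert (Hmu : 0 < mu) by (unfold mu; lra).
  (* The numerator is [(u ^ 2 - 1 / 2) ^ 2 + 2 * mu], hence at least [2 * mu]. For [v < u < 1] the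
     denominator is below [8 * (1 - v) = 2 * mu / K ^ 2], so the quotient exceeds [K ^ 2]. *)
  set (v := 1 - mu / (4 * K ^ 2)).
  assert (Hv : (1 - v) * (4 * K ^ 2) = mu) by (unfold v; field; lra).
  assert (Hv1 : v < 1) by nra.
  assert (G : forall u, 1 / 2 < u -> v < u -> u < 1 ->
    Q (- 2 * u * sqrt ((u ^ 4 - u ^ 2 + 2 * lam) / (4 * (1 - u ^ 2))))).
  { intros u U1 U2 U3. apply HN.
    assert (K < sqrt ((u ^ 4 - u ^ 2 + 2 * lam) / (4 * (1 - u ^ 2)))); [|nra].
    rewrite <- (sqrt_pow2 K) by lra. apply sqrt_lt_1_alt. split; [apply pow2_ge_0|].
    assert (0 < 4 * (1 - u ^ 2)) by nra.
    apply (Rmult_lt_reg_r (4 * (1 - u ^ 2))); auto.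
    unfold Rdiv. rewrite Rmult_assoc, Rinv_l, Rmult_1_r by lra.
    assert (A1 : 2 * mu <= u ^ 4 - u ^ 2 + 2 * lam).
    { unfold mu. pose proof (pow2_ge_0 (u ^ 2 - 1 / 2)). nra. }
    assert (A2 : 4 * (1 - u ^ 2) < 8 * (1 - v)) by nra.
    assert (A3 : 0 < K ^ 2) by nra.
    pose proof (Rmult_lt_compat_l _ _ _ A3 A2). lra. }
  unfold filtermap, at_left, within.
  apply (locally_interval _ 1 (Rmax (1 / 2) v) p_infty); simpl; auto.
  - apply Rmax_lub_lt; lra.
  - intros u U _ U3. pose proof (Rmax_l (1 / 2) v). pose proof (Rmax_r (1 / 2) v).
    apply G; lra.
Qed.

Lemma nonperiodic_curve (lam : R) :
  1 / 8 <= lam ->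
  exists C, solution lam 0 0 C /\
    (forall d t, solution lam 0 0 d -> dom d t -> dom C t) /\
    (forall t, dom C t -> 0 < t -> pos C t < 0) /\
    (1 / 8 < lam -> approaches_singularity C).
Proof.
  intros Hlam.
  (* With [x = - u ^ 2] and [y = - 2 * u * u'], cancelling [4 * u ^ 2] in the energy identity gives
     the square of [u']. *)
  set (P := fun u => (u ^ 4 - u ^ 2 + 2 * lam) / (4 * (1 - u ^ 2))).
  (* [M] is where [P] first fails to be positive and finite: its pole 1 if [lam > 1 / 8]; if
     [lam = 1 / 8], the double root of [u ^ 4 - u ^ 2 + 1 / 4], where [u ^ 2 = 1 / 2]. *)
  assert (exists M, 0 < M /\
    (forall u, Rabs u < M -> u ^ 2 < 1 /\ 0 < u ^ 4 - u ^ 2 + 2 * lam) /\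
    (M = 1 \/ M ^ 2 = 1 / 2 /\ lam = 1 / 8) /\ (1 / 8 < lam -> M = 1))
    as [M [M0 [HM [HM1 HM2]]]].
  { destruct (Rle_lt_or_eq_dec _ _ Hlam) as [L|L].
    - exists 1. split; [lra|split; [|split; auto]].
      intros u Hu. apply Rabs_def2 in Hu.
      pose proof (pow2_ge_0 (u ^ 2 - 1 / 2)). split; nra.
    - exists (sqrt (1 / 2)).
      assert (S0 : 0 < sqrt (1 / 2)) by (apply sqrt_lt_R0; lra).
      assert (S2 : sqrt (1 / 2) ^ 2 = 1 / 2) by (apply pow2_sqrt; lra).
      split; [auto|split; [|split; [auto|lra]]].
      intros u Hu. apply Rabs_def2 in Hu.
      assert (u ^ 2 < 1 / 2) by nra.
      split; [lra|]. rewrite <- L. nra. }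
  destruct (chart_solution lam M P
    (fun u => ((4 * u ^ 3 - 2 * u) * (1 - u ^ 2) + (u ^ 4 - u ^ 2 + 2 * lam) * (2 * u))
        / (4 * (1 - u ^ 2) ^ 2))
    (fun u => - u ^ 2) (fun u => - 2 * u) (fun _ => - 2))
    as [tau [s [Ht [Hs0 [Hs [Hmono [Hsurj Hsol]]]]]]].
  - exact M0.
  - ring.
  - ring.
  - intros u Hu. destruct (HM u Hu) as [U1 U2].
    unfold P. split; [|split; [|split; [|split; [|split; [|split]]]]].
    + apply Rdiv_lt_0_compat; lra.
    + replace (- u) with (-1 * u) by ring. rewrite !Rpow_mult_distr.
      f_equal; ring.
    + auto_derive; [simpl in *; lra|]. field. lra.
    + auto_derive; [auto|]. ring.
    + auto_derive; [auto|]. ring.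
    + lra.
    + field. lra.
  - set (C := symmetric_curve _ _ _) in Hsol.
    exists C. split; [exact Hsol|].
    assert (B0 : Rbar_lt (Rabs 0) tau) by (rewrite Rabs_R0; auto).
    assert (Hs' : forall t, Rbar_lt (Rabs t) tau -> Rabs (s t) < M) by (intros; now apply Hs).
    split; [|split].
    + intros d t. apply (dom_symmetric_of_half lam tau); auto.
      clear d t. intros d t Hd Dt L.
      destruct tau as [r| |]; [|exact I|easy]. simpl in Ht |- *.
      apply Rnot_le_lt. intros Lr.
      (* A solution defined at [r] would have position [- M ^ 2] there. If [M = 1] this leaves the
         region [x > -1]; otherwise its velocity is 0 and it sits at the equilibrium. *)
      assert (Dr : dom d r).
      { destruct Hd as [D0 _]. apply (dom_between d 0 t); auto. lra. }
      assert (Hagree : forall t, 0 < t < r -> pos d t = pos C t /\ vel d t = vel C t).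
      { intros z Hz. apply (solution_unique lam 0 0); auto; [lra| |].
        - destruct Hd as [D0 _]. apply (dom_between d 0 r); auto. lra.
        - apply dom_symmetric_curve. simpl. apply Rabs_def1; lra. }
      destruct (proj2 (proj2 (proj2 Hd)) r Dr) as [X1 [DX DY]].
      assert (EX : pos d r = - M ^ 2).
      { apply (endpoint_value M (Finite r) s (fun u => - u ^ 2) (pos d) r); auto.
        - apply (ex_derive_continuous (fun u => - u ^ 2)). auto_derive. auto.
        - apply (ex_derive_continuous (pos d)). now exists (vel d r).
        - intros z Hz. now apply Hagree. }
      destruct HM1 as [E|[E1 E2]]; [rewrite E in EX; lra|].
      assert (EY : vel d r = - 2 * M * sqrt (P M)).
      { apply (endpoint_value M (Finite r) s (fun u => - 2 * u * sqrt (P u)) (vel d) r); auto.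
        - apply (continuous_mult (fun u => - 2 * u) (fun u => sqrt (P u))).
          + apply (ex_derive_continuous (fun u => - 2 * u)). auto_derive. auto.
          + apply (continuous_comp P sqrt); [|apply continuous_sqrt].
            apply (ex_derive_continuous P). unfold P. auto_derive. simpl in *; lra.
        - apply (ex_derive_continuous (vel d)). now eexists; eassumption.
        - intros z Hz. now apply Hagree. }
      assert (EP : P M = 0).
      { unfold P. replace (M ^ 4) with ((M ^ 2) ^ 2) by ring. rewrite E1, E2. field. }
      rewrite EP, sqrt_0 in EY.
      subst lam. apply (equilibrium_not_reached d r Hd Dr); lra.
    + intros t Dt L. apply dom_symmetric_curve in Dt. simpl.
      assert (s 0 < s t) by auto. rewrite Hs0 in *. nra.
    + intros L. specialize (HM2 L). subst M.
      assert (F : filterlim s (to_tmax C) (at_left 1))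
        by (apply filterlim_reparametrization; auto).
      split.
      * apply (filterlim_comp _ _ _ s (fun u => - u ^ 2) (to_tmax C) (at_left 1)); auto.
        assert (Hc : continuous (fun u => - u ^ 2) 1).
        { apply (ex_derive_continuous (fun u => - u ^ 2)). auto_derive. auto. }
        intros Q HQ. apply (filter_imp (F := locally 1) (fun u => Q (- u ^ 2))); [auto|].
        apply Hc. now replace (- 1 ^ 2) with (-1) by ring.
      * apply (filterlim_comp _ _ _ s (fun u => - 2 * u * sqrt (P u))
          (to_tmax C) (at_left 1)); auto.
        now apply filterlim_velocity_m_infty.
Qed.

(** * Transfer to every maximal solution *)

(** The filter bounds times by [tmax c] only from above; near that end-point they exceed 0, which
    gives the lower bound. Curves agreeing on the domain thus share their limits. *)
Lemma to_tmax_dom (c : curve) : dom c 0 -> to_tmax c (dom c).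
Proof.
  intros [A B]. unfold to_tmax, within, dom.
  destruct (tmax c) as [r| |]; simpl in *; [| |easy].
  - apply (locally_interval _ r 0 p_infty); simpl; auto.
    intros y Y _ Y'. split; auto. now apply Rbar_lt_trans with 0.
  - exists 0. intros y Y _. split; auto. now apply Rbar_lt_trans with 0.
Qed.

Theorem proposition1 :
  exists lamd : R,
    (0 < lamd < 4 / 27) /\
    (forall lam : R, 0 < lam ->
       (exists c : curve, maximal_solution lam 0 0 c) /\
       (forall c : curve, maximal_solution lam 0 0 c ->
          (periodic c <-> lam < lamd) /\
          (lamd < lam -> approaches_singularity c))) /\
    lamd = 1 / 8.
Proof.
  exists (1 / 8). split; [lra|]. split; [|reflexivity].
  intros lam Hlam. destruct (Rlt_le_dec lam (1 / 8)) as [L|L].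
  - destruct (periodic_curve lam (conj Hlam L)) as [C [HC [Hall [_ [T [HT Hper]]]]]].
    destruct (maximal_of_largest lam C Hlam HC) as [HCm HCu]; [auto|].
    split; [now exists C|]. intros c Hc.
    assert (E := HCu c Hc).
    split; [|lra]. split; [auto|]. intros _. split.
    + intros t. now apply E.
    + exists T. split; auto. intros t.
      destruct (E t) as [_ [E1 E2]]; auto. destruct (E (t + T)) as [_ [E3 E4]]; auto.
      rewrite E1, E2, E3, E4. apply Hper.
  - destruct (nonperiodic_curve lam L) as [C [HC [Hlarge [Hneg Happ]]]].
    destruct (maximal_of_largest lam C Hlam HC Hlarge) as [HCm HCu].
    split; [now exists C|]. intros c Hc.
    assert (E := HCu c Hc). destruct Hc as [[D0 [X0 _]] _].
    split.
    (* A period [T] would bring the position back to 0 at a positive time, where it is strictly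
       negative. *)
    + split; [|lra]. intros [Hdom [T [HT Hper]]].
      destruct (Hper 0) as [Ep _]. rewrite Rplus_0_l, X0 in Ep.
      assert (DT : dom C T) by now apply E.
      destruct (E T) as [_ [E1 _]]; auto.
      specialize (Hneg T DT HT). lra.
    + intros L'. destruct (Happ L') as [A1 A2].
      assert (Et : to_tmax c = to_tmax C).
      { unfold to_tmax. rewrite (tmax_eq c C); auto. intros t. apply E. }
      assert (Hd : to_tmax C (dom C)) by (apply to_tmax_dom; apply HC).
      assert (FC : Filter (to_tmax C)) by (unfold to_tmax; typeclasses eauto).
      split; rewrite Et.
      * apply (filterlim_ext_loc (pos C)); [|exact A1].
        apply (filter_imp (dom C)); [|exact Hd].
        intros t Dt. symmetry. now apply E.
      * apply (filterlim_ext_loc (vel C)); [|exact A2].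
        apply (filter_imp (dom C)); [|exact Hd].
        intros t Dt. symmetry. now apply E.
Qed.
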